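(* Let $n\ge 2$ and let $\Omega\subset\mathbb{R}^n$ be a compact connected set with smooth boundary, having the origin in its interior, which is star-shaped in the sense that $\Omega=\{x : \|x\|\le 1\}$, where $\|x\|:=\inf\{\lambda>0 : x\in\lambda\Omega\}$. Let $f$ be a smooth function on $\Omega$. Then $$\mathrm{Var}_{\lambda_\Omega} f\le \frac{4}{n^2}\int_\Omega \langle x,\nabla f\rangle^2\, d\lambda_\Omega + 2\,\mathrm{Var}_{\sigma_{\partial\Omega}} f .$$
   Context: $\lambda_\Omega$ denotes the uniform (normalized Lebesgue) probability measure on $\Omega$. The cone probability measure $\sigma_{\partial\Omega}$ on $\partial\Omega$ is the push-forward of $\lambda_\Omega$ via the map $x\mapsto x/\|x\|$; equivalently $\sigma_{\partial\Omega}=\frac{1}{|\Omega|}\frac{\langle x,\nu\rangle}{n}\,\mathcal{H}^{n-1}|_{\partial\Omega}$, where $\nu$ is the unit exterior normal to $\partial\Omega$, $\mathcal{H}^{n-1}$ is the $(n-1)$-dimensional Hausdorff measure and $|\Omega|$ is the volume of $\Omega$. For a probability measure $\mu$, $\mathrm{Var}_\mu f:=\int f^2\,d\mu-(\int f\,d\mu)^2$. *)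

(* Defs.v *)
From HB Require Import structures.
From mathcomp Require Import all_boot all_order all_algebra.
From mathcomp Require Import all_classical all_reals all_analysis.

Set Implicit Arguments.
Unset Strict Implicit.
Unset Printing Implicit Defensive.

Import Order.TTheory GRing.Theory Num.Theory.
Import numFieldNormedType.Exports.

Local Open Scope classical_set_scope.
Local Open Scope ring_scope.

(* R^n is 'rV[R]_n; its sigma-algebra is the one generated by the coordinate
   maps, that is, the n-fold product of the Borel sigma-algebra of R. *)
Definition rV_display : measure_display.
Proof. exact. Qed.

Section measurable_rV.
Context (R : realType) (n : nat).

Let coords : 'I_n -> 'rV[R]_n -> measurableTypeR R := fun i x => x ord0 i.

Let rV_set0 : g_sigma_preimage coords set0.
Proof. exact: sigma_algebra0. Qed.

Let rV_setC A : g_sigma_preimage coords A -> g_sigma_preimage coords (~` A).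
Proof. exact: sigma_algebraC. Qed.

Let rV_bigcup (F : (set 'rV[R]_n)^nat) :
  (forall i, g_sigma_preimage coords (F i)) ->
  g_sigma_preimage coords (\bigcup_i (F i)).
Proof. exact: sigma_algebra_bigcup. Qed.

HB.instance Definition _ := @isMeasurable.Build rV_display 'rV[R]_n
  (g_sigma_preimage coords) rV_set0 rV_setC rV_bigcup.

Lemma measurable_coord (i : 'I_n) :
  measurable_fun [set: 'rV[R]_n] (fun x => x ord0 i : measurableTypeR R).
Proof.
move=> _ Y mY; rewrite setTI; apply: sub_sigma_algebra => /=.
rewrite -bigcup_seq/=; exists i => /=; first by rewrite mem_index_enum.
by exists Y => //; rewrite setTI.
Qed.

Lemma measurable_fun_coordP d (T : measurableType d) (f : T -> 'rV[R]_n) :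
  (forall i, measurable_fun [set: T] (fun t => f t ord0 i : measurableTypeR R))
  -> measurable_fun [set: T] f.
Proof.
move=> mf; apply: (@measurability _ _ _ _ _ _ (\big[setU/set0]_(i < n)
  preimage_set_system setT (coords i) measurable)) => //.
move=> _ [B + <-]; rewrite -bigcup_seq/= => -[i _ [C mC <-]].
by rewrite !setTI -comp_preimage -[X in measurable X]setTI; exact: mf.
Qed.

End measurable_rV.

Lemma product_sigma_finite d1 d2 (T1 : measurableType d1)
    (T2 : measurableType d2) (R : realType)
    (m1 : {sigma_finite_measure set T1 -> \bar R})
    (m2 : {sigma_finite_measure set T2 -> \bar R}) :
  sigma_finite setT (m1 \x m2)%E.
Proof.
have /sigma_finiteP[F [TF ndF Foo]] := sigma_finiteT m1.
have /sigma_finiteP[G [TG ndG Goo]] := sigma_finiteT m2.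
exists (fun n => F n `*` G n).
  rewrite -setXTT TF TG predeqE => -[x y]; split.
    move=> [/= [n _ Fnx] [k _ Gky]]; exists (maxn n k) => //; split.
    - by move: x Fnx; exact/subsetPset/ndF/leq_maxl.
    - by move: y Gky; exact/subsetPset/ndG/leq_maxr.
  by move=> [n _ []/= ? ?]; split; exists n.
move=> k; have [? ?] := Foo k; have [? ?] := Goo k.
split; first exact: measurableX.
by rewrite product_measure1E// lte_mul_pinfty// ge0_fin_numE.
Qed.

Section cons_rV.
Context (R : realType) (n : nat).

Definition cons_rV (p : measurableTypeR R * 'rV[R]_n) : 'rV[R]_n.+1 :=
  \row_i oapp (p.2 ord0) p.1 (unlift ord0 i).

Definition uncons_rV (x : 'rV[R]_n.+1) : measurableTypeR R * 'rV[R]_n :=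
  (x ord0 ord0, \row_j x ord0 (lift ord0 j)).

Lemma cons_rVK : cancel cons_rV uncons_rV.
Proof.
move=> [a v]; rewrite /uncons_rV !mxE unlift_none /=; congr pair.
by apply/rowP => j; rewrite !mxE liftK.
Qed.

Lemma measurable_cons_rV : measurable_fun [set: _] cons_rV.
Proof.
apply: measurable_fun_coordP => i; under eq_fun do rewrite mxE.
case: (unlift ord0 i) => [j|] /=; last exact: measurable_fst.
exact: (measurableT_comp (measurable_coord j) measurable_snd).
Qed.

Lemma measurable_uncons_rV : measurable_fun [set: _] uncons_rV.
Proof.
apply: measurable_fun_pair; first exact: measurable_coord.
apply: measurable_fun_coordP => i /=.
by under eq_fun do rewrite mxE; exact: measurable_coord.
Qed.

Variable mu : {sigma_finite_measure set 'rV[R]_n -> \bar R}.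

Definition lebesgue_cons : set 'rV[R]_n.+1 -> \bar R :=
  pushforward (@lebesgue_measure R \x mu)%E cons_rV.

Let lebesgue_cons0 : lebesgue_cons set0 = 0%E.
Proof. by rewrite /lebesgue_cons /pushforward preimage_set0 measure0. Qed.

Let lebesgue_cons_ge0 A : (0 <= lebesgue_cons A)%E.
Proof. by rewrite /lebesgue_cons /pushforward; exact: measure_ge0. Qed.

Let lebesgue_cons_sigma_additive : semi_sigma_additive lebesgue_cons.
Proof.
have mc A : measurable A -> measurable (cons_rV @^-1` A).
  by move=> mA; rewrite -[X in measurable X]setTI; exact: measurable_cons_rV.
move=> F mF tF mUF; rewrite /lebesgue_cons /pushforward preimage_bigcup.
apply: measure_semi_sigma_additive.
- by move=> i; exact: mc.
- apply/trivIsetP => /= i j _ _ ij; rewrite -preimage_setI.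
  by move/trivIsetP : tF => /(_ _ _ _ _ ij) ->//; rewrite preimage_set0.
- by rewrite -preimage_bigcup; exact: mc.
Qed.

HB.instance Definition _ := isMeasure.Build _ _ _ lebesgue_cons
  lebesgue_cons0 lebesgue_cons_ge0 lebesgue_cons_sigma_additive.

Let lebesgue_cons_sigma_finite : sigma_finite setT lebesgue_cons.
Proof.
have [F TF Foo] := product_sigma_finite (@lebesgue_measure R) mu.
exists (fun i => uncons_rV @^-1` F i).
  by rewrite -preimage_bigcup -TF preimage_setT.
move=> i; have [mF Fioo] := Foo i; split.
  by rewrite -[X in measurable X]setTI; exact: measurable_uncons_rV.
rewrite /lebesgue_cons /pushforward -comp_preimage.
by rewrite (_ : _ \o _ = id) ?preimage_id//; apply/funext/cons_rVK.
Qed.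

HB.instance Definition _ := Measure_isSigmaFinite.Build _ _ _ lebesgue_cons
  lebesgue_cons_sigma_finite.

End cons_rV.

(* Lebesgue measure on R^n: the n-fold product of Lebesgue measure on R. *)
Fixpoint lebesgue_rV (R : realType) (n : nat) :
    {sigma_finite_measure set 'rV[R]_n -> \bar R} :=
  match n with
  | 0 => \d_(0 : 'rV[R]_0)
  | m.+1 => lebesgue_cons (lebesgue_rV R m)
  end.

Lemma lebesgue_rV_box (R : realType) (n : nat)
    (B : 'I_n -> set (measurableTypeR R)) :
  (forall i, measurable (B i)) ->
  measurable [set x : 'rV[R]_n | forall i, B i (x ord0 i)] /\
  lebesgue_rV R n [set x | forall i, B i (x ord0 i)] =
    (\prod_(i < n) lebesgue_measure (B i))%E.
Proof.
elim: n B => [|n IH] B mB.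
  rewrite big_ord0.
  have H0 : [set x : 'rV[R]_0 | forall i, B i (x ord0 i)] = setT by apply/seteqP; split => // x _ [].
  split; first by rewrite H0; exact: measurableT.
  by rewrite /= diracE mem_set //; case.
have [mI eI] := IH _ (fun i => mB (lift ord0 i)).
have E : cons_rV (n:=n) @^-1` [set x | forall i, B i (x ord0 i)] =
   B ord0 `*` [set x : 'rV[R]_n | forall i, B (lift ord0 i) (x ord0 i)].
  apply/seteqP; split => -[a v] /=.
    move=> H; split => [|i]; first by have := H ord0; rewrite mxE unlift_none.
    by have := H (lift ord0 i); rewrite mxE liftK.
  move=> [/= Ha Hv] i; rewrite mxE; case: unliftP => [j ->|->] //=.
have mu : measurable (@uncons_rV R n @^-1` (B ord0 `*` [set x : 'rV[R]_n | forall i, B (lift ord0 i) (x ord0 i)])).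
  rewrite -[X in measurable X]setTI; apply: measurable_uncons_rV => //; exact: measurableX.
split.
  move: mu; congr measurable; apply/seteqP; split => x /=.
    move=> [/= H H'] i; case: (unliftP ord0 i) => [j ->|->] //.
    by have := H' j; rewrite mxE.
  by move=> H; split => //= i; rewrite mxE.
rewrite big_ord_recl -eI /= /lebesgue_cons /pushforward E.
by rewrite product_measure1E.
Qed.

Section definitions.
Context (R : realType) (n : nat).
Implicit Types (x y : 'rV[R]_n) (f g : 'rV[R]_n -> R) (U Omega : set 'rV[R]_n).

Definition dotmul x y : R := \sum_i x ord0 i * y ord0 i.

Definition partial (i : 'I_n) f : 'rV[R]_n -> R :=
  'D_(delta_mx ord0 i : 'rV[R]_n) f.

Definition grad f x : 'rV[R]_n := \row_i partial i f x.

Fixpoint Ck (k : nat) U f : Prop :=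
  match k with
  | 0 => forall x, U x -> {for x, continuous f}
  | m.+1 => (forall x, U x -> differentiable f x) /\
            (forall i, Ck m U (partial i f))
  end.

Definition smooth_on_open U f := forall k, Ck k U f.

(* Smooth up to the boundary: smooth on an open neighbourhood of Omega.  A
   smooth function given only on a compact Omega is identified with such an
   extension, which also gives meaning to its gradient on the boundary. *)
Definition smooth_on Omega f :=
  exists2 U, open U /\ Omega `<=` U & smooth_on_open U f.

Definition bdry Omega : set 'rV[R]_n := closure Omega `\` interior Omega.

(* Near each boundary point, Omega is a sublevel set of a smooth function
   without critical points. *)
Definition smooth_boundary Omega :=
  forall p, bdry Omega p -> exists U g,
    [/\ open U, U p, smooth_on_open U g,
        forall x, U x -> grad g x != 0 &
        Omega `&` U = [set x | g x <= 0] `&` U].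

Definition gauge Omega x : R :=
  inf [set l : R | 0 < l /\ exists2 y, Omega y & x = l *: y].

Definition uniform_measure Omega : set 'rV[R]_n -> \bar R :=
  fun A => (lebesgue_rV R n (A `&` Omega) *
            ((fine (lebesgue_rV R n Omega))^-1)%:E)%E.

(* The value of the map at x = 0 is irrelevant, {0} being a null set. *)
Definition cone_measure Omega : set 'rV[R]_n -> \bar R :=
  pushforward (uniform_measure Omega) (fun x => (gauge Omega x)^-1 *: x).

(* D is the set carrying mu; the values of f outside D are ignored. *)
Definition Var (mu : set 'rV[R]_n -> \bar R) (D : set 'rV[R]_n) f : \bar R :=
  (\int[mu]_(x in D) (f x ^+ 2)%:E - (\int[mu]_(x in D) (f x)%:E) ^+ 2)%E.

End definitions.

(* Main.v *)
Require Import Defs.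
From HB Require Import structures.
From mathcomp Require Import all_boot all_order all_algebra.
From mathcomp Require Import all_classical all_reals all_analysis measurable_realfun.
From mathcomp Require Import ring lra.

Set Implicit Arguments.
Unset Strict Implicit.
Unset Printing Implicit Defensive.

Import Order.TTheory GRing.Theory Num.Theory.
Import numFieldNormedType.Exports.

Local Open Scope classical_set_scope.
Local Open Scope ring_scope.

(** Write [radial x] for the point [x / gauge x] of the boundary on the ray through
    [x], [mean] for the integral against the uniform probability [uniform] of
    [Omega], and [g x] for [<x, grad f x>].  The cone measure is by definition the
    law of [radial x], so its integrals are means of functions of [radial x]
    ([cone_integral]).

    The core of the proof is the divergence theorem for the field [F x *: x], which
    in polar form reads
      [n * mean F + mean <x, grad F> = n * mean (F \o radial)]
    ([divergence_identity]).  It is applied to [F = (f - m) ^ 2], where [m] is the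
    mean of [f] for the cone measure.  Then [<x, grad F> = 2 * (f - m) * g] is at
    least [- n / 2 * F - 2 / n * g ^ 2] pointwise, so
      [mean F <= 4 / n ^ 2 * mean (g ^ 2) + 2 * mean (F \o radial)],
    and the last mean is the variance of [f] for the cone measure, while [mean F] is
    at least the variance of [f] for [uniform] ([variance_le]).

    The divergence identity needs no surface measure and no polar coordinates, only
    the fact that dilating by [t] multiplies Lebesgue measure by [t ^ n]
    ([lebesgue_rV_scale]).  Put [D = F - F \o radial]; this function vanishes on
    the boundary and has the same radial derivative as [F], because
    [F \o radial] is constant on rays, so the identity becomes
    [n * mean D + mean <x, grad F> = 0].  The quotients
    [(D x - D (t x)) / (1 - t)] tend to [<x, grad F x>] as [t] increases to 1 and
    are uniformly bounded, hence their means converge too.  By scaling, [t ^ n] times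
    the mean of such a quotient is
      [- (1 + t + ... + t ^ (n - 1)) * mean D]
    up to the integral of [D / (1 - t)] over the part of [Omega] outside
    [t *: Omega].  On this collar [D] is of size [1 - t], and the collar has
    measure [1 - t ^ n], so this error vanishes in the limit
    ([difference_quotient_bound]).

    Since the gauge may be discontinuous (the boundary may contain radial segments),
    only its measurability is used; it holds because the sublevel sets of the gauge
    are dilates of the closed set [Omega]. *)

(** * Lebesgue measure and Borel sets of R^n *)

Lemma lebesgue_measure_scale (R : realType) (t : R) (A : set (measurableTypeR R)) :
  0 < t -> measurable A ->
  lebesgue_measure (( *%R t : measurableTypeR R -> measurableTypeR R) @^-1` A) =
    ((t^-1)%:E * lebesgue_measure A)%E.
Proof.
move=> t0 mA; pose s : measurableTypeR R -> measurableTypeR R := *%R t.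
have ms : measurable_fun setT s by exact: mulrl_measurable.
suff -> : lebesgue_measure A = (t%:E * lebesgue_measure (s @^-1` A))%E.
  by rewrite muleA -EFinM mulVf ?gt_eqF// mul1e.
apply: (@lebesgue_measure_unique _
  (mscale (NngNum (ltW t0)) (pushforward (@lebesgue_measure R) s))) => //.
move=> _ [[a b]] _ <-; rewrite /mscale /= /pushforward.
transitivity (t%:E * lebesgue_measure (`](a / t)%R, (b / t)%R]%classic : set R))%E; last first.
  congr (_ * lebesgue_measure _)%E; apply/seteqP; split => x /=;
    by rewrite !in_itv/= /s ltr_pdivrMr// ler_pdivlMr// ![x * t]mulrC.
rewrite !lebesgue_measure_itv/= !lte_fin ltr_pM2r ?invr_gt0//.
case: ifPn => // ab; last by rewrite mule0.
by rewrite -!EFinB -EFinM -mulrBl mulrCA divff ?mulr1// gt_eqF.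
Qed.

(** Fubini on the slices of the product [lebesgue_cons] reduces the scaling by
    [t] to one factor [t^-1] per coordinate. *)
Lemma lebesgue_rV_scale (R : realType) (n : nat) (t : R) (A : set 'rV[R]_n) :
  0 < t -> measurable A ->
  lebesgue_rV R n ( *:%R t @^-1` A) = ((t ^- n)%:E * lebesgue_rV R n A)%E.
Proof.
move=> t0; elim: n A => [|n IH] A mA.
  rewrite expr0 invr1 mul1e; congr (lebesgue_rV _ _ _).
  by apply/funext => x /=; congr A; apply/rowP => -[].
rewrite /= /lebesgue_cons /pushforward /product_measure1 /=.
set B := cons_rV (n:=n) @^-1` A.
have mB : measurable B.
  by rewrite -[B]setTI; exact: measurable_cons_rV.
pose s : measurableTypeR R -> measurableTypeR R := *%R t.
have ms : measurable_fun setT s by exact: mulrl_measurable.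
pose g a := lebesgue_rV R n (xsection B a).
have mg : measurable_fun setT g by exact: measurable_fun_xsection.
have gs a : lebesgue_rV R n (xsection (cons_rV (n:=n) @^-1` ( *:%R t @^-1` A)) a) =
    ((t ^- n)%:E * (g \o s) a)%E.
  rewrite /= -IH; last exact: measurable_xsection.
  congr (lebesgue_rV _ _ _); apply/seteqP; split => v;
    rewrite /xsection /= !inE /B /=; congr A;
    by apply/rowP => i; rewrite !mxE; case: unlift => [j|] //=; rewrite mxE.
under eq_integral do rewrite gs.
rewrite ge0_integralZl//; first last.
- by rewrite lee_fin invr_ge0 exprn_ge0// ltW.
- exact: measurableT_comp.
rewrite exprSr invfM EFinM -muleA; congr (_ * _)%E.
have -> : (\int[lebesgue_measure]_x g (s x) =
    \int[pushforward lebesgue_measure s]_x g x)%E.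
  by rewrite ge0_integral_pushforward// => x _; exact: measure_ge0.
have ti : 0 <= t^-1 by rewrite invr_ge0 ltW.
rewrite -(@ge0_integral_mscale _ _ _ _ _ measurableT (NngNum ti))//.
by apply: eq_measure_integral => C mC _; exact: (lebesgue_measure_scale t0 mC).
Qed.

Lemma lebesgue_rV_cube (R : realType) (n : nat) (r : R) : 0 <= r ->
  measurable [set x : 'rV[R]_n | forall i, ball 0 r (x ord0 i)] /\
  lebesgue_rV R n [set x | forall i, ball 0 r (x ord0 i)] = ((r *+ 2) ^+ n)%:E.
Proof.
move=> r0.
have [i|mB ->] := @lebesgue_rV_box R n (fun=> ball 0 r); first exact: measurable_ball.
split => //; under eq_bigr do rewrite lebesgue_measure_ball//.
by elim: n {mB} => [|m IH]; rewrite ?big_ord0// big_ord_recr /= IH -EFinM -exprSr.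
Qed.

(** Cubes with rational centres and radii of the form [1 / (k + 1)] form a
    countable base of the topology. *)
Lemma open_measurable_rV (R : realType) (n : nat) (O : set 'rV[R]_n) :
  open O -> measurable O.
Proof.
move=> oO.
pose B (p : 'rV[rat]_n * nat) : set 'rV[R]_n :=
  [set x | forall i, ball (ratr (p.1 ord0 i) : R) p.2.+1%:R^-1 (x ord0 i)].
have mB p : measurable (B p).
  apply: (@lebesgue_rV_box R n (fun i => ball (ratr (p.1 ord0 i) : R) p.2.+1%:R^-1) _).1.
  by move=> i; exact: measurable_ball.
(* [unpickle] turns the union over the countable type of centres and radii into
   one over [nat]. *)
pose F m := if unpickle m is Some p then
  if `[< B p `<=` O >] then B p else set0 else set0.
suff -> : O = \bigcup_m F m.
  apply: bigcupT_measurable => m; rewrite /F.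
  by case: unpickle => // p; case: ifPn.
apply/seteqP; split=> [x Ox|x [m _]]; last first.
  by rewrite /F; case: unpickle => // p; case: ifPn => // /asboolP; exact.
have /nbhs_ballP[e /= e0 eO] := open_nbhs_nbhs (conj oO Ox).
have e20 : 0 < e / 2 by rewrite divr_gt0.
have [k _ /(_ _ (leqnn k)) ke] := near_infty_natSinv_lt (PosNum e20).
have k0 : 0 < k.+1%:R^-1 :> R by rewrite invr_gt0.
have /choice[q qx] (i : 'I_n) : exists q : rat, ball (x ord0 i) k.+1%:R^-1 (ratr q).
  have : x ord0 i - k.+1%:R^-1 < x ord0 i + k.+1%:R^-1.
    by rewrite ltrBlDr -addrA ltrDl addr_gt0.
  case/rat_in_itvoo => q /itvP iq; exists q.
  by rewrite /ball /= ltr_distlC; apply/andP; split; rewrite iq.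
pose p := (\row_i q i, k).
exists (pickle p) => //; rewrite /F pickleK.
have Bx : B p x by move=> i; rewrite /= mxE; exact/ball_sym/qx.
rewrite ifT//; apply/asboolP => y By; apply: eO; split => // i j.
rewrite (ord1 i).
rewrite [X in ball _ X](splitr e).
apply: (@ball_triangle _ _ (ratr (q j) : R)); apply: le_ball (ltW ke) _ _.
  exact: qx.
by have := By j; rewrite /= mxE.
Qed.

Lemma closed_measurable_rV (R : realType) (n : nat) (C : set 'rV[R]_n) :
  closed C -> measurable C.
Proof.
move=> cC; rewrite -[C]setCK; apply: measurableC.
by apply: open_measurable_rV; exact: closed_openC.
Qed.

Lemma continuous_measurable_fun_rV (R : realType) (n : nat) (D : set 'rV[R]_n)
    (g : 'rV[R]_n -> R) :
  measurable D -> (forall x, D x -> {for x, continuous g}) ->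
  measurable_fun D g.
Proof.
move=> mD cg; apply: (measurability _ (RGenOInfty.measurableE R)) => //.
move=> /= _ [_ [a ->] <-].
rewrite (_ : D `&` _ = D `&` interior (g @^-1` `]a, +oo[)); last first.
  apply/seteqP; split => [x [Dx gx]|x [Dx /interior_subset]]; last by [].
  split => //; apply: (cg x Dx); apply: open_nbhs_nbhs; split => //.
by apply: measurableI => //; apply: open_measurable_rV; exact: open_interior.
Qed.

Lemma measurable_set1_rV (R : realType) (n : nat) (x : 'rV[R]_n) :
  measurable [set x].
Proof.
apply: closed_measurable_rV; apply: accessible_closed_set1.
by apply: hausdorff_accessible; exact: norm_hausdorff.
Qed.

Lemma measurable_scale (R : realType) (n : nat) (t : R) :
  measurable_fun setT (fun x : 'rV[R]_n => t *: x).
Proof.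
apply: measurable_fun_coordP => i; under eq_fun do rewrite mxE.
by apply: measurable_funM => //; exact: measurable_coord.
Qed.

(** * The gauge and the radial projection *)

Section star_body.
Context (R : realType) (n : nat) (Omega : set 'rV[R]_n).
Hypothesis Omega_compact : compact Omega.
Hypothesis Omega_origin : interior Omega 0.
Hypothesis Omega_star : Omega = [set x | gauge Omega x <= 1].
Implicit Types (x y : 'rV[R]_n) (t : R).

(** The map pushing the uniform measure to the cone measure; it fixes the origin
    because the inverse of 0 is 0. *)
Definition radial x : 'rV[R]_n := (gauge Omega x)^-1 *: x.

Lemma in_gaugeE x : Omega x <-> gauge Omega x <= 1.
Proof. by rewrite [in X in X <-> _]Omega_star. Qed.

Lemma measurable_body : measurable Omega.
Proof.
apply: closed_measurable_rV; apply: compact_closed Omega_compact.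
exact: norm_hausdorff.
Qed.

Lemma gauge_has_inf x :
  has_inf [set l : R | 0 < l /\ exists2 y, Omega y & x = l *: y].
Proof.
split; last by exists 0 => l [/ltW].
have /nbhs_ballP[e /= e0 eO] := Omega_origin.
have l0 : 0 < (`|x| + 1) / e by rewrite divr_gt0// ltr_wpDl.
exists ((`|x| + 1) / e); split=> //; exists (((`|x| + 1) / e)^-1 *: x).
  apply: eO; rewrite -ball_normE /= sub0r normrN normrZ gtr0_norm ?invr_gt0//.
  by rewrite invf_div mulrAC ltr_pdivrMr ?ltr_wpDl// ltr_pM2l// ltrDl.
by rewrite scalerA divff ?gt_eqF// scale1r.
Qed.

Lemma gauge_ge0 x : 0 <= gauge Omega x.
Proof. by apply: lb_le_inf; [exact: (gauge_has_inf x).1|move=> l [/ltW]]. Qed.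

Lemma gauge_le t y : 0 < t -> Omega y -> gauge Omega (t *: y) <= t.
Proof.
by move=> t0 Oy; apply: ge_inf; [exact: (gauge_has_inf _).2|split => //; exists y].
Qed.

Lemma gaugeZ t x : 0 < t -> gauge Omega (t *: x) = t * gauge Omega x.
Proof.
move: t x; suff leZ t x : 0 < t -> gauge Omega (t *: x) <= t * gauge Omega x.
  move=> t x t0; apply/eqP; rewrite eq_le leZ//= -ler_pdivlMl//.
  by rewrite -{1}(scalerK (lt0r_neq0 t0) x) leZ// invr_gt0.
move=> t0; rewrite mulrC -ler_pdivrMr//; apply: lb_le_inf.
  exact: (gauge_has_inf x).1.
move=> l [l0 [y Oy ->]]; rewrite ler_pdivrMr// scalerA mulrC.
by apply: gauge_le => //; rewrite mulr_gt0.
Qed.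

Lemma gauge0 : gauge Omega 0 = 0.
Proof.
have := @gaugeZ 2 0 (ltr0n _ 2); rewrite scaler0 => /eqP.
by rewrite -subr_eq0 -{1}[gauge _ _]mul1r -mulrBl mulf_eq0 => /orP[/eqP|/eqP//]; lra.
Qed.

Lemma gauge_gt0 x : x != 0 -> 0 < gauge Omega x.
Proof.
move=> x0; have [M [_ MO]] := compact_bounded Omega_compact.
have M0 : 0 < `|M| + 1 by rewrite ltr_wpDl.
apply: (@lt_le_trans _ _ (`|x| / (`|M| + 1))); first by rewrite divr_gt0 ?normr_gt0.
apply: lb_le_inf; first exact: (gauge_has_inf x).1.
move=> l [l0 [y Oy ->]]; rewrite normrZ gtr0_norm// ler_pdivrMr// ler_pM2l//.
by apply: MO => //; rewrite (le_lt_trans (ler_norm _))// ltrDl.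
Qed.

Lemma body_scale t x : 0 < t -> t <= 1 -> Omega x -> Omega (t *: x).
Proof. by move=> t0 t1 Ox; apply/in_gaugeE; rewrite (le_trans (gauge_le t0 Ox)). Qed.

Lemma body_scaleE t x : 0 < t -> Omega (t^-1 *: x) <-> gauge Omega x <= t.
Proof.
by move=> t0; rewrite in_gaugeE gaugeZ ?invr_gt0// mulrC ler_pdivrMr// mul1r.
Qed.

Lemma radialZ t x : 0 < t -> radial (t *: x) = radial x.
Proof.
move=> t0; rewrite /radial gaugeZ// scalerA invfM mulrAC mulVf ?gt_eqF//.
by rewrite mul1r.
Qed.

Lemma gaugeK x : gauge Omega x *: radial x = x.
Proof.
have [->|x0] := eqVneq x 0; first by rewrite /radial !scaler0.
by rewrite /radial scalerA divff ?scale1r// gt_eqF// gauge_gt0.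
Qed.

Lemma gauge_radial x : x != 0 -> gauge Omega (radial x) = 1.
Proof.
by move=> x0; rewrite gaugeZ ?invr_gt0 ?gauge_gt0// mulVf// gt_eqF// gauge_gt0.
Qed.

Lemma body_radial x : Omega (radial x).
Proof.
apply/in_gaugeE; have [->|x0] := eqVneq x 0; last by rewrite gauge_radial.
by rewrite /radial scaler0 gauge0.
Qed.

Lemma bdry_sub : bdry Omega `<=` Omega.
Proof.
move=> x [+ _]; rewrite -(closure_id _).1//.
by apply: compact_closed Omega_compact; exact: norm_hausdorff.
Qed.

(** Dilating such a point by any factor larger than one leaves [Omega].  The
    converse fails when the boundary contains a radial segment: the gauge is less
    than one at all but one end of it. *)
Lemma gauge1_bdry x : gauge Omega x = 1 -> bdry Omega x.
Proof.
move=> x1; split; first by apply/subset_closure/in_gaugeE; rewrite x1.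
move=> xO.
have : \forall s \near (1 : R), Omega (s *: x).
  apply: (@scalel_continuous _ _ x 1); rewrite scale1r; exact: xO.
move=> /nbhs_ballP[e /= e0 eO].
have /eO/in_gaugeE : ball (1 : R) e (1 + e / 2).
  by rewrite /ball /= opprD addNKr normrN gtr0_norm; lra.
by rewrite gaugeZ ?x1; lra.
Qed.

Lemma preimage_radial_bdry : radial @^-1` (bdry Omega) = ~` [set 0].
Proof.
apply/seteqP; split => x /=.
  by move=> [_ +] x0; rewrite x0 /radial scaler0; exact.
by move=> /eqP x0; apply: gauge1_bdry; exact: gauge_radial.
Qed.

Lemma measurable_bdry : measurable (bdry Omega).
Proof.
apply: measurableD; first by apply: closed_measurable_rV; exact: closed_closure.
by apply: open_measurable_rV; exact: open_interior.
Qed.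

(** For [a > 0], the set where the gauge is at most [a] is the dilate
    [a *: Omega], hence closed; continuity of the gauge may fail. *)
Lemma measurable_gauge : measurable_fun setT (gauge Omega).
Proof.
apply: (measurability _ (RGenOInfty.measurableE R)) => //.
move=> /= _ [_ [a ->] <-]; rewrite setTI.
have [a0|a0|->] := ltgtP a 0.
- rewrite (_ : _ @^-1` _ = setT)//; apply/seteqP; split => // x _ /=.
  by rewrite in_itv/= andbT (lt_le_trans a0)// gauge_ge0.
- rewrite (_ : _ @^-1` _ = ~` ((fun x => a^-1 *: x) @^-1` Omega)).
    apply: measurableC; rewrite -[X in measurable X]setTI.
    by apply: measurable_scale => //; exact: measurable_body.
  apply/seteqP; split => x /=; rewrite in_itv/= andbT body_scaleE//.
    by rewrite leNgt => ->.
  by move/negP; rewrite -ltNge.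
- rewrite (_ : _ @^-1` _ = ~` [set 0]).
    by apply: measurableC; exact: measurable_set1_rV.
  apply/seteqP; split => x /=; rewrite in_itv/= andbT.
    by move=> + x0; rewrite x0 gauge0 ltxx.
  by move=> /eqP; exact: gauge_gt0.
Qed.

Lemma measurable_radial : measurable_fun setT radial.
Proof.
apply: measurable_fun_coordP => i; under eq_fun do rewrite mxE.
apply: measurable_funM; last exact: measurable_coord.
(* The real power with exponent [-1] also sends 0 to 0, so it agrees with the
   inverse on all values of the gauge, including the one at the origin. *)
under eq_fun do rewrite -powR_inv1 ?gauge_ge0//.
apply: (@measurableT_comp _ _ _ _ _ _ (@powR R ^~ (-1))).
  exact: measurable_powR.
exact: measurable_gauge.
Qed.

Lemma measurable_fun_radial (g : 'rV[R]_n -> R) :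
  measurable_fun Omega g -> measurable_fun Omega (g \o radial).
Proof.
move=> mg; apply: (measurable_comp measurable_body _ mg).
  by move=> _ [x Ox <-]; exact: body_radial.
by apply: measurable_funTS; exact: measurable_radial.
Qed.

Lemma measurable_fun_dilation t (g : 'rV[R]_n -> R) : 0 < t -> t <= 1 ->
  measurable_fun Omega g -> measurable_fun Omega (fun x => g (t *: x)).
Proof.
move=> t0 t1 mg; apply: (measurable_comp measurable_body _ mg).
  by move=> _ [x Ox <-]; exact: body_scale.
by apply: measurable_funTS; exact: measurable_scale.
Qed.

(** * The uniform probability measure *)

Lemma lebesgue_body_lty : (lebesgue_rV R n Omega < +oo)%E.
Proof.
have [M [_ MO]] := compact_bounded Omega_compact.
have M0 : 0 <= `|M| + 2 by rewrite addr_ge0.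
have [mB B] := lebesgue_rV_cube n M0.
apply: (@le_lt_trans _ _ (lebesgue_rV R n [set x | forall i, ball 0 (`|M| + 2) (x ord0 i)])).
  apply: le_measure; rewrite ?inE//; first exact: measurable_body.
  move=> x Ox i; rewrite /ball /= sub0r normrN.
  apply: (@le_lt_trans _ _ `|x|); last first.
    apply: (@le_lt_trans _ _ (`|M| + 1)); last by lra.
    by apply: MO => //; rewrite (le_lt_trans (ler_norm _))// ltrDl.
  rewrite [`|x|]mx_normrE; exact: (le_bigmax _ (fun ij => `|x ij.1 ij.2|) (ord0, i)).
by rewrite B ltry.
Qed.

Lemma lebesgue_body_gt0 : (0 < lebesgue_rV R n Omega)%E.
Proof.
have /nbhs_ballP[e /= e0 eO] := Omega_origin.
have [mB B] := lebesgue_rV_cube n (ltW e0).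
apply: (@lt_le_trans _ _ (lebesgue_rV R n [set x | forall i, ball 0 e (x ord0 i)])).
  by rewrite B lte_fin exprn_gt0// pmulrn_lgt0.
apply: le_measure; rewrite ?inE//; first exact: measurable_body.
by move=> x Bx; apply: eO; split => // i j; rewrite (ord1 i) mxE; exact: Bx.
Qed.

Let c := (fine (lebesgue_rV R n Omega))^-1.

Let c0 : 0 <= c.
Proof. by rewrite invr_ge0 fine_ge0. Qed.

(** The same set function as [uniform_measure Omega], as a bundled measure. *)
Definition uniform : {measure set 'rV[R]_n -> \bar R} :=
  mscale (NngNum c0) (mrestr (lebesgue_rV R n) measurable_body).

Lemma uniform_measureE : uniform_measure Omega = uniform.
Proof. by apply/funext => A; rewrite /uniform_measure muleC. Qed.

Lemma uniformE A : uniform A = (c%:E * lebesgue_rV R n (A `&` Omega))%E.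
Proof. by []. Qed.

Lemma uniform_body : uniform Omega = 1%E.
Proof.
have fO : lebesgue_rV R n Omega \is a fin_num.
  by rewrite ge0_fin_numE// lebesgue_body_lty.
rewrite uniformE setIid -[X in (_ * X)%E]fineK// -EFinM mulVf//.
by rewrite gt_eqF// fine_gt0// lebesgue_body_gt0 lebesgue_body_lty.
Qed.

Lemma uniformI A : measurable A -> uniform A = uniform (A `&` Omega).
Proof. by move=> mA; rewrite !uniformE -setIA setIid. Qed.

Lemma uniform_lty A : measurable A -> (uniform A < +oo)%E.
Proof.
move=> mA; rewrite uniformI//; apply: (@le_lt_trans _ _ (uniform Omega)).
  by apply: le_measure; rewrite ?inE//; [apply: measurableI => //|]; exact: measurable_body.
by rewrite uniform_body ltry.
Qed.

Lemma uniform_origin : (0 < n)%N -> uniform [set 0] = 0%E.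
Proof.
move=> n0; rewrite uniformE.
have -> : [set 0] `&` Omega = [set x | forall i : 'I_n, [set (0 : R)] (x ord0 i)].
  apply/seteqP; split => x /= => [[-> _ i]|x0]; first by rewrite mxE.
  have -> : x = 0 by apply/rowP => i; rewrite mxE x0.
  by split => //; apply: interior_subset.
have [_|_ ->] := @lebesgue_rV_box R n (fun=> [set 0]); first exact: measurable_set1.
rewrite (bigD1 (Ordinal n0))//= lebesgue_measure_set1 mul0e mule0//.
Qed.

Definition dilate t := [set x | gauge Omega x <= t].

Lemma measurable_dilate t : measurable (dilate t).
Proof.
rewrite -[dilate t]setTI (_ : dilate t = gauge Omega @^-1` `]-oo, t]).
  exact: measurable_gauge.
by apply/seteqP; split => x /=; rewrite in_itv.
Qed.

Lemma dilate_sub t : t <= 1 -> dilate t `<=` Omega.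
Proof. by move=> t1 x xt; apply/in_gaugeE; exact: le_trans t1. Qed.

Lemma preimage_dilate t : 0 < t -> *:%R t @^-1` (dilate t) = Omega.
Proof.
move=> t0; apply/seteqP; split => x /=; rewrite /dilate/= gaugeZ// in_gaugeE;
  by rewrite -ler_pdivlMl// mulVf// gt_eqF.
Qed.

(** The restriction to subsets of [dilate t] ensures that both [A] and its preimage
    lie in [Omega], where [uniform] is proportional to Lebesgue measure. *)
Lemma uniform_scale t A : 0 < t -> t <= 1 -> measurable A -> A `<=` dilate t ->
  uniform ( *:%R t @^-1` A) = ((t ^- n)%:E * uniform A)%E.
Proof.
move=> t0 t1 mA At; rewrite !uniformE.
rewrite (_ : _ `&` Omega = *:%R t @^-1` A); last first.
  by apply/setIidl; rewrite -(preimage_dilate t0) => x /=; exact: At.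
rewrite (_ : _ `&` Omega = A); last by apply/setIidl => x /At/(dilate_sub t1).
by rewrite lebesgue_rV_scale// muleCA.
Qed.

Lemma uniform_dilate t : 0 < t -> t <= 1 -> uniform (dilate t) = (t ^+ n)%:E.
Proof.
move=> t0 t1; have := @uniform_scale t (dilate t) t0 t1 (measurable_dilate t).
rewrite preimage_dilate// uniform_body => /(_ (@subset_refl _ _)) /(congr1 (mule (t ^+ n)%:E)).
by rewrite mule1 muleA -EFinM mulfV ?mul1e// expf_neq0// gt_eqF.
Qed.

Lemma uniform_integrable A (g : 'rV[R]_n -> R) C : measurable A ->
  measurable_fun A g -> (forall x, A x -> `|g x| <= C) ->
  uniform.-integrable A (EFin \o g).
Proof.
move=> mA mg gC; apply: measurable_bounded_integrable => //.
  exact: uniform_lty.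
exists C; split; first exact: num_real.
by move=> D CD x Ax /=; rewrite (le_trans (gC x Ax))// ltW.
Qed.

Lemma ge0_integral_scale t (g : 'rV[R]_n -> R) C : 0 < t -> t <= 1 ->
  measurable_fun Omega g -> (forall x, Omega x -> 0 <= g x <= C) ->
  \int[uniform]_(x in Omega) g (t *: x) =
  t ^- n * \int[uniform]_(x in dilate t) g x.
Proof.
move=> t0 t1 mg g0.
have tn : 0 <= t ^- n by rewrite invr_ge0 exprn_ge0// ltW.
have mD := measurable_dilate t.
have mgD : measurable_fun (dilate t) (EFin \o g).
  apply/measurable_EFinP; apply: measurable_funS mg; [exact: measurable_body|exact: dilate_sub].
have gD0 x : dilate t x -> (0 <= (g x)%:E)%E.
  by move=> Dx; have /g0/andP[] := dilate_sub t1 Dx.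
rewrite /Rintegral; transitivity (fine (\int[pushforward uniform ( *:%R t)]_(x in dilate t) (g x)%:E)).
  rewrite ge0_integral_pushforward//.
  - by rewrite preimage_dilate.
  - exact: measurable_scale.
  - by move=> x /set_mem; exact: gD0.
transitivity (fine (\int[mscale (NngNum tn) uniform]_(x in dilate t) (g x)%:E)).
  congr fine; apply: eq_measure_integral => [|? A mA At]; first exact: measurable_scale.
  exact: (uniform_scale t0 t1 mA At).
rewrite ge0_integral_mscale//= fineM//.
apply: integrable_fin_num => //; apply: (@uniform_integrable _ _ C) => //.
  by apply/measurable_EFinP.
by move=> x /(dilate_sub t1)/g0/andP[gx0 gxC]; rewrite ger0_norm.
Qed.

Lemma Rintegral_scale t (g : 'rV[R]_n -> R) C : 0 < t -> t <= 1 ->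
  measurable_fun Omega g -> (forall x, Omega x -> `|g x| <= C) ->
  \int[uniform]_(x in Omega) g (t *: x) =
  t ^- n * \int[uniform]_(x in dilate t) g x.
Proof.
move=> t0 t1 mg gC.
have C0 : 0 <= C by apply: le_trans (gC 0 _); rewrite ?normr_ge0//; exact: interior_subset.
have mO := measurable_body; have mD := measurable_dilate t.
have sO x : Omega x -> Omega (t *: x) by exact: body_scale.
have mgt : measurable_fun Omega (fun x => g (t *: x)).
  exact: measurable_fun_dilation.
have mgD : measurable_fun (dilate t) g.
  by apply: measurable_funS mg => //; exact: dilate_sub.
have iC A : measurable A -> uniform.-integrable A (EFin \o cst C).
  by move=> mA; apply: (@uniform_integrable _ _ C) => // x _; rewrite ger0_norm.
(* The nonnegative case applies to [g + C] and to the constant [C]. *)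
have := @ge0_integral_scale t (fun x => g x + C) (C + C) t0 t1.
rewrite RintegralD//; last 2 first.
- by apply: (@uniform_integrable _ _ C) => // x /sO; exact: gC.
- exact: iC.
rewrite RintegralD//; last 2 first.
- by apply: (@uniform_integrable _ _ C) => // x /(dilate_sub t1); exact: gC.
- exact: iC.
rewrite mulrDr -(@ge0_integral_scale t (cst C) C)//; last by move=> x _; rewrite lexx C0.
move=> H; apply: (@addIr _ (\int[uniform]_(x in Omega) C)); apply: H.
  exact: measurable_funD.
by move=> x /gC; rewrite ler_norml => /andP[? ?]; lra.
Qed.

(** * The divergence identity *)

Section divergence.
Variables (F G : 'rV[R]_n -> R) (C : R).
Hypothesis mF : measurable_fun Omega F.
Hypothesis mG : measurable_fun Omega G.
Hypothesis FC : forall x, Omega x -> `|F x| <= C.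
Hypothesis GC : forall x, Omega x -> `|G x| <= C.
(* [G] plays the role of [<x, grad F x>]: differentiating [F] along the ray through
   [x] at [s *: x] gives [<x, grad F (s *: x)>], that is [s^-1 * G (s *: x)]. *)
Hypothesis dF : forall x (s : R), Omega x -> 0 < s -> s <= 1 ->
  is_derive s 1 (fun s : R => F (s *: x)) (s^-1 * G (s *: x)).

Let mO : measurable Omega := measurable_body.

(** The mean value theorem along a ray; away from the origin, for [s >= 1 / 2], the
    derivative [s^-1 * G (s *: x)] is at most [2 * C]. *)
Lemma radial_increment x t : Omega x -> 2^-1 <= t -> t <= 1 ->
  `|F x - F (t *: x)| <= C *+ 2 * (1 - t).
Proof.
move=> Ox t2 t1; have t0 : 0 < t by lra.
pose phi (s : R) : R := F (s *: x).
pose dphi (s : R) : R := s^-1 * G (s *: x).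
have dFx (s : R) : s \in `[t, 1]%R -> is_derive s 1 phi (dphi s).
  rewrite in_itv/= => /andP[ts s1].
  by apply: dF => //; exact: lt_le_trans ts.
have cFx : {within `[t, 1]%classic, continuous phi}.
  by apply: derivable_within_continuous => s /dFx[].
have dFx' (s : R) : s \in `]t, 1[%R -> is_derive s 1 phi (dphi s).
  by move=> /subset_itv_oo_cc; exact: dFx.
have [s] := MVT_segment t1 dFx' cFx.
rewrite /phi /dphi in_itv/= => /andP[ts s1]; rewrite scale1r => ->.
have s0 : 0 < s by exact: lt_le_trans ts.
rewrite normrM [`|1 - t|]ger0_norm ?subr_ge0//; apply: ler_wpM2r; first by rewrite subr_ge0.
rewrite normrM mulrC -mulr_natr ler_pM//; first by apply: GC; exact: body_scale.
by rewrite gtr0_norm ?invr_gt0// -[leRHS]invrK lef_pV2 ?posrE ?invr_gt0//; lra.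
Qed.

(** The deviation of [F] from the 0-homogeneous extension of its boundary
    values. *)
Let D x := F x - F (radial x).

Let mFr : measurable_fun Omega (F \o radial).
Proof. exact: measurable_fun_radial. Qed.

Let mD : measurable_fun Omega D.
Proof. exact: measurable_funB. Qed.

Let DC x : Omega x -> `|D x| <= C + C.
Proof.
move=> Ox; rewrite (le_trans (ler_normB _ _))// lerD ?FC//; exact: body_radial.
Qed.

Let D_collar t x : 2^-1 <= t -> Omega x -> ~ dilate t x ->
  `|D x| <= C *+ 2 * (1 - t).
Proof.
move=> t2 Ox /negP; rewrite -ltNge => tx; rewrite distrC.
have x1 : gauge Omega x <= 1 by exact/in_gaugeE.
have C0 : 0 <= C by rewrite (le_trans _ (FC Ox)).
apply: (@le_trans _ _ (C *+ 2 * (1 - gauge Omega x))); last first.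
  by rewrite ler_wpM2l ?mulrn_wge0//; lra.
rewrite -{2}(gaugeK x); apply: radial_increment => //.
  exact: body_radial.
by rewrite (le_trans t2)// ltW.
Qed.

(** The quotient is the same for [F] and for [D], as their difference is constant on
    rays.  Rescaling the integral of [D (t *: x)] to one over [dilate t], the two
    terms add up to [(1 - t)^-1] times the integral of [D] over the collar
    [Omega `\` dilate t], where [D] is at most [2 * C * (1 - t)]; the measure of
    the collar is [1 - t ^ n]. *)
Lemma difference_quotient_bound t : 2^-1 <= t -> t < 1 ->
  `|t ^+ n * (\int[uniform]_(x in Omega) ((1 - t)^-1 * (F x - F (t *: x))))
    + (\sum_(i < n) t ^+ i) * \int[uniform]_(x in Omega) D x|
  <= C *+ 2 * (1 - t ^+ n).
Proof.
move=> t2 t1; have t0 : 0 < t by lra.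
have mdt := measurable_dilate t; have sdt := dilate_sub (ltW t1).
have mE : measurable (Omega `\` dilate t) by exact: measurableD.
have sO x : Omega x -> Omega (t *: x) by apply: body_scale => //; exact: ltW.
have mDt : measurable_fun Omega (fun x => D (t *: x)).
  by apply: (measurable_fun_dilation _ _ mD) => //; exact: ltW.
have iD : uniform.-integrable Omega (EFin \o D) by exact: uniform_integrable DC.
have iDt : uniform.-integrable Omega (EFin \o (fun x => D (t *: x))).
  by apply: (uniform_integrable _ mDt) => // x /sO; exact: DC.
have iE : uniform.-integrable (Omega `\` dilate t) (EFin \o D).
  by apply: integrableS iD => //; exact: subDsetl.
have Esplit : \int[uniform]_(x in Omega) D x = \int[uniform]_(x in dilate t) D x
    + \int[uniform]_(x in Omega `\` dilate t) D x.
  rewrite -Rintegral_setU//; first by rewrite setDUK.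
    by rewrite setDUK.
  by apply/disj_setPS => x [? []].
under eq_Rintegral => x _.
  rewrite (_ : F x - F (t *: x) = D x - D (t *: x)); last by rewrite /D radialZ//; ring.
  over.
rewrite RintegralZl//; last exact: (integrableB mO iD iDt).
rewrite RintegralB// (Rintegral_scale t0 (ltW t1) mD DC).
set I := \int[uniform]_(x in Omega) D x in Esplit *.
set J := \int[uniform]_(x in dilate t) D x in Esplit *.
set K := \int[uniform]_(x in _) D x in Esplit.
have tn0 : t ^+ n != 0 by rewrite expf_neq0// gt_eqF.
have u0 : 0 < 1 - t by rewrite subr_gt0.
have sumE : \sum_(i < n) t ^+ i = (1 - t)^-1 * (1 - t ^+ n).
  by rewrite -[1 - t ^+ n]opprB subrX1 -mulNr opprB mulKf ?gt_eqF.
have -> : t ^+ n * ((1 - t)^-1 * (I - t ^- n * J)) + (\sum_(i < n) t ^+ i) * I =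
    (1 - t)^-1 * K.
  by rewrite sumE Esplit; field; rewrite tn0 lt0r_neq0.
rewrite normrM gtr0_norm ?invr_gt0// ler_pdivrMl//.
apply: (le_trans (le_normr_Rintegral mE iE)).
apply: (@le_trans _ _ (\int[uniform]_(x in Omega `\` dilate t) (C *+ 2 * (1 - t)))).
  apply: le_Rintegral => //.
  - exact: integrable_norm.
  - apply: (@uniform_integrable _ _ `|C *+ 2 * (1 - t)|) => //.
  - by move=> x [Ox xt]; exact: D_collar.
rewrite Rintegral_cst// measureD//; last by rewrite uniform_lty.
rewrite setIidr//.
rewrite [X in (X - _)%E]uniform_body [X in (_ - X)%E]uniform_dilate//; last exact: ltW.
by rewrite -EFinB /= mulrAC mulrC.
Qed.

(* The dilation factors [1 - u k] are at least 1 / 2 and below 1, as the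
   bounds above require. *)
Let u (k : nat) : R := k.+2%:R^-1.

Let u_gt0 k : 0 < u k. Proof. by rewrite invr_gt0. Qed.

Let u_le k : u k <= 2^-1.
Proof. by rewrite lef_pV2 ?posrE// ler_nat. Qed.

Let cvg_u : u @ \oo --> 0.
Proof. by rewrite (_ : u = [sequence harmonic k.+1]_k)// cvg_shiftS; exact: cvg_harmonic. Qed.

Let q k x := (1 - (1 - u k))^-1 * (F x - F ((1 - u k) *: x)).

Let cvg_q x : Omega x -> q ^~ x @ \oo --> G x.
Proof.
move=> Ox; have [dFx] := dF Ox ltr01 (lexx 1).
rewrite invr1 mul1r scale1r => <-.
pose phi (s : R) : R := F (s *: x).
pose r (h : R) : R := h^-1 *: ((phi \o shift 1) (h *: (1 : R)) - phi 1).
have cr : r @ (0 : R)^' --> 'D_1 phi (1 : R) by exact: dFx.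
have cu : (fun k => - u k) @ \oo --> (0 : R)^'.
  have u0 : (fun k => - u k) @ \oo --> (0 : R).
    by rewrite -[X in _ --> X]oppr0; exact: cvgN.
  move=> A A0; have : \forall k \near \oo, - u k != 0 -> A (- u k) by exact: u0 A0.
  by apply: filterS => k; apply; rewrite oppr_eq0 gt_eqF.
rewrite (_ : q ^~ x = r \o (fun k => - u k)); last first.
  apply/funext => k; rewrite /q /r /phi /= subKr [_ *: 1]mulr1 scale1r invrN.
  by rewrite -[in RHS]opprB scaleNr scalerN opprK [- u k + 1]addrC.
exact: cvg_comp cu cr.
Qed.

(** The divergence theorem for the vector field [F x *: x]: its divergence is
    [n * F + G], and its outer flux is, up to normalization, [n] times the mean of
    [F] for the cone measure.  It is the limit of [difference_quotient_bound] as the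
    dilation factor tends to 1. *)
Lemma divergence_identity :
  n%:R * \int[uniform]_(x in Omega) F x + \int[uniform]_(x in Omega) G x =
  n%:R * \int[uniform]_(x in Omega) F (radial x).
Proof.
have FrC x : Omega x -> `|F (radial x)| <= C by move=> _; apply: FC; exact: body_radial.
have iF : uniform.-integrable Omega (EFin \o F) by exact: uniform_integrable FC.
have iFr : uniform.-integrable Omega (EFin \o (F \o radial)).
  exact: (uniform_integrable mO mFr FrC).
have iG : uniform.-integrable Omega (EFin \o G) by exact: uniform_integrable GC.
pose a k := (1 - u k) ^+ n * \int[uniform]_(x in Omega) q k x
  + (\sum_(i < n) (1 - u k) ^+ i) * \int[uniform]_(x in Omega) D x.
have cvg1u : (fun k => 1 - u k) @ \oo --> (1 : R).
  by rewrite -[X in _ --> X]subr0; apply: cvgB => //; exact: cvg_cst.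
have cvg1un : (fun k => (1 - u k) ^+ n) @ \oo --> (1 : R).
  rewrite -[X in _ --> X](expr1n R n).
  apply: (@continuous_cvg _ _ _ _ _ (fun k => 1 - u k) (fun x : R => x ^+ n) 1) => //.
  exact: exprn_continuous.
have mq k : measurable_fun Omega (q k).
  have /andP[u0 u1] : 0 < 1 - u k <= 1 by have := u_gt0 k; have := u_le k; lra.
  apply: measurable_funM => //; apply: measurable_funB => //.
  exact: measurable_fun_dilation.
have qC k x : Omega x -> `|q k x| <= C *+ 2.
  move=> Ox; rewrite /q subKr normrM gtr0_norm ?invr_gt0// ler_pdivrMl// mulrC.
  rewrite -[X in _ * X](subKr 1); apply: radial_increment => //;
    by have := u_gt0 k; have := u_le k; lra.
have cvg_int : (fun k => \int[uniform]_(x in Omega) q k x) @ \oo -->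
    \int[uniform]_(x in Omega) G x.
  have mqE k : measurable_fun Omega (EFin \o q k) by exact/measurable_EFinP.
  have mGE : measurable_fun Omega (EFin \o G) by exact/measurable_EFinP.
  have qG : {ae uniform, forall x, Omega x -> (EFin \o q k) x @[k --> \oo] --> (EFin \o G) x}.
    by apply: aeW => x Ox; apply: cvg_EFin; [exact: nearW|exact: cvg_q].
  have iC : uniform.-integrable Omega (cst (C *+ 2)%:E).
    exact: (@uniform_integrable _ (cst (C *+ 2)) `|C *+ 2|).
  have qCE : {ae uniform, forall x k, Omega x -> (`|(EFin \o q k) x| <= cst (C *+ 2)%:E x)%E}.
    by apply: aeW => x k Ox; rewrite /= lee_fin qC.
  have [_ _] := dominated_convergence mO mqE mGE qG iC qCE.
  rewrite -[X in _ --> X -> _]fineK; last exact: integrable_fin_num.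
  exact: fine_cvg.
have cvg_a : a @ \oo --> \int[uniform]_(x in Omega) G x +
    n%:R * \int[uniform]_(x in Omega) D x.
  rewrite -[X in _ --> X + _]mul1r; apply: cvgD; first exact: cvgM.
  apply: cvgM; last exact: cvg_cst.
  pose p : {poly R} := \sum_(i < n) 'X^i.
  have pE t : \sum_(i < n) t ^+ i = p.[t].
    by rewrite horner_sum; apply: eq_bigr => i _; rewrite hornerXn.
  under eq_fun do rewrite pE.
  have -> : n%:R = p.[1].
    rewrite -pE (eq_bigr (fun=> 1)) => [|i _]; last by rewrite expr1n.
    by rewrite sumr_const card_ord.
  apply: (@continuous_cvg _ _ _ _ _ (fun k => 1 - u k) (horner p) 1) => //.
  exact: continuous_horner.
have cvg_a0 : a @ \oo --> (0 : R).
  apply: norm_cvg0.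
  apply: (@squeeze_cvgr nat \oo _ R (cst 0)
    (fun k => C *+ 2 * (1 - (1 - u k) ^+ n)) (fun k => `|a k|)).
  - apply: nearW => k; rewrite normr_ge0/=.
      have /andP[] : 2^-1 <= 1 - u k < 1 by have := u_gt0 k; have := u_le k; lra.
    exact: difference_quotient_bound.
  - exact: cvg_cst.
  - have c1 : (fun k => 1 - (1 - u k) ^+ n) @ \oo --> (1 - 1 : R).
      by apply: cvgB; [exact: cvg_cst|exact: cvg1un].
    rewrite -[X in _ --> X](mulr0 (C *+ 2)) -(subrr (1 : R)).
    by apply: cvgM; [exact: cvg_cst|exact: c1].
have := cvg_unique (@Rhausdorff R) cvg_a cvg_a0.
rewrite RintegralB//= => H; apply/eqP; rewrite -subr_eq0 -H; apply/eqP; ring.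
Qed.

End divergence.

(** * The variance inequality *)

Lemma Rintegral_fineK A (g : 'rV[R]_n -> R) B : measurable A ->
  measurable_fun A g -> (forall x, A x -> `|g x| <= B) ->
  (\int[uniform]_(x in A) (g x)%:E)%E = (\int[uniform]_(x in A) g x)%:E.
Proof.
move=> mA mg gB; rewrite fineK//.
by apply: integrable_fin_num => //; exact: uniform_integrable gB.
Qed.

Lemma Rintegral_sqrB (g : 'rV[R]_n -> R) B (m : R) : measurable_fun Omega g ->
  (forall x, Omega x -> `|g x| <= B) ->
  \int[uniform]_(x in Omega) (g x - m) ^+ 2 =
  \int[uniform]_(x in Omega) g x ^+ 2 - 2 * m * \int[uniform]_(x in Omega) g x + m ^+ 2.
Proof.
move=> mg gB; have mO := measurable_body.
have mg2 : measurable_fun Omega (fun x => g x ^+ 2) by exact: measurable_funX.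
have i2 : uniform.-integrable Omega (EFin \o (fun x => g x ^+ 2)).
  apply: (@uniform_integrable _ _ (B ^+ 2)) => // x Ox.
  by rewrite normrX ler_pXn2r ?nnegrE ?gB//; rewrite (le_trans _ (gB _ Ox)).
have i1 : uniform.-integrable Omega (EFin \o g) by exact: uniform_integrable gB.
have i0 : uniform.-integrable Omega (EFin \o cst (m ^+ 2)).
  by apply: (@uniform_integrable _ _ `|m ^+ 2|).
have i1' : uniform.-integrable Omega (EFin \o (fun x => 2 * m * g x)).
  apply: (@uniform_integrable _ _ (`|2 * m| * B)) => //.
    exact: measurable_funM.
  by move=> x Ox; rewrite normrM ler_wpM2l// gB.
under eq_Rintegral => x _.
  rewrite (_ : _ ^+ 2 = g x ^+ 2 - 2 * m * g x + m ^+ 2); last by ring.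
  over.
rewrite RintegralD//; last exact: (integrableB mO i2 i1').
rewrite RintegralB// RintegralZl// Rintegral_cst//.
by rewrite [X in fine X]uniform_body /= mulr1.
Qed.

Local Notation mean := (Rintegral uniform Omega).

(** For [F = (f - m) ^ 2] and [G = 2 * (f - m) * g] the divergence identity gives
    [n * mean F <= n * mean (F \o radial) + n / 2 * mean F + 2 / n * mean (g ^ 2)];
    absorbing the middle term yields the constants 2 and [4 / n ^ 2].  Taking for [m]
    the mean of [f \o radial] turns [mean (F \o radial)] into a variance, and any
    constant [m] makes [mean F] at least the variance of [f]. *)
Lemma variance_le (f g : 'rV[R]_n -> R) C : (0 < n)%N ->
  measurable_fun Omega f -> measurable_fun Omega g ->
  (forall x, Omega x -> `|f x| <= C) -> (forall x, Omega x -> `|g x| <= C) ->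
  (forall x (s : R), Omega x -> 0 < s -> s <= 1 ->
    is_derive s 1 (fun s : R => f (s *: x)) (s^-1 * g (s *: x))) ->
  mean (fun x => f x ^+ 2) - mean f ^+ 2 <=
  4 / n%:R ^+ 2 * mean (fun x => g x ^+ 2) +
  2 * (mean (fun x => f (radial x) ^+ 2) - mean (f \o radial) ^+ 2).
Proof.
move=> n_gt0 mf mg fC gC df.
have mO := measurable_body.
have C0 : 0 <= C by apply: le_trans (fC 0 _); rewrite ?normr_ge0//; exact: interior_subset.
have mfr : measurable_fun Omega (f \o radial).
  exact: measurable_fun_radial.
have frC x : Omega x -> `|f (radial x)| <= C by move=> _; apply: fC; exact: body_radial.
pose m := mean (f \o radial).
pose F x := (f x - m) ^+ 2.
pose G x := 2 * (f x - m) * g x.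
pose B := C + `|m|.
have B0 : 0 <= B by rewrite addr_ge0.
have fmB x : Omega x -> `|f x - m| <= B.
  by move=> Ox; rewrite (le_trans (ler_normB _ _))// lerD2r fC.
have mfm : measurable_fun Omega (fun x => f x - m) by exact: measurable_funB.
have mF : measurable_fun Omega F by exact: measurable_funX.
have mG : measurable_fun Omega G.
  by apply: measurable_funM => //; exact: measurable_funM.
have mg2 : measurable_fun Omega (fun x => g x ^+ 2) by exact: measurable_funX.
pose K := B ^+ 2 + 2 * B * C.
have FK x : Omega x -> `|F x| <= K.
  move=> Ox; rewrite normrX (@le_trans _ _ (B ^+ 2))//.
    by rewrite ler_pXn2r ?nnegrE ?fmB.
  by rewrite lerDl !mulr_ge0.
have GK x : Omega x -> `|G x| <= K.
  move=> Ox; rewrite (@le_trans _ _ (2 * B * C))//; last by rewrite lerDr exprn_ge0.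
  rewrite !normrM [`|2|]ger0_norm//; apply: ler_pM; rewrite ?mulr_ge0 ?gC//.
  by rewrite ler_pM2l ?fmB.
have dF x (s : R) : Omega x -> 0 < s -> s <= 1 ->
    is_derive s 1 (fun s : R => F (s *: x)) (s^-1 * G (s *: x)).
  move=> Ox s0 s1; have dfx := df x s Ox s0 s1.
  pose phi (s : R) : R := f (s *: x).
  have dphi : is_derive s (1 : R) (phi - cst m) (s^-1 * g (s *: x)).
    by apply: is_derive_eq; rewrite subr0.
  apply: (@is_derive_eq _ _ _ ((phi - cst m) ^+ 2)).
  rewrite /G; change (2 * (f (s *: x) - m) ^+ 1 * (s^-1 * g (s *: x)) =
    s^-1 * (2 * (f (s *: x) - m) * g (s *: x))).
  by ring.
have iF : uniform.-integrable Omega (EFin \o F) by exact: uniform_integrable FK.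
have iG : uniform.-integrable Omega (EFin \o G) by exact: uniform_integrable GK.
have ig2 : uniform.-integrable Omega (EFin \o (fun x => g x ^+ 2)).
  apply: (@uniform_integrable _ _ (C ^+ 2)) => // x Ox.
  by rewrite normrX ler_pXn2r ?nnegrE ?gC.
have n0 : 0 < n%:R :> R by rewrite ltr0n.
have EG : - (n%:R / 2) * mean F - 2 / n%:R * mean (fun x => g x ^+ 2) <= mean G.
  have iF' := integrableZl mO (- (n%:R / 2)) iF.
  have ig2' := integrableZl mO (2 / n%:R) ig2.
  rewrite -!RintegralZl// -RintegralB//.
  apply: le_Rintegral => //; first exact: (integrableB mO iF' ig2').
  move=> x Ox; rewrite -subr_ge0.
  (* The weighted AM-GM inequality, as a square. *)
  rewrite (_ : _ - _ = 2 / n%:R * (g x + n%:R / 2 * (f x - m)) ^+ 2).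
    by rewrite mulr_ge0 ?sqr_ge0// divr_ge0// ltW.
  by rewrite /G /F; field; rewrite gt_eqF.
have EF : mean F = mean (fun x => f x ^+ 2) - 2 * m * mean f + m ^+ 2.
  exact: Rintegral_sqrB mf fC.
have EFr : mean (F \o radial) = mean (fun x => f (radial x) ^+ 2) - 2 * m * m + m ^+ 2.
  exact: Rintegral_sqrB mfr frC.
have div : n%:R * mean F + mean G = n%:R * mean (F \o radial).
  exact: divergence_identity mF mG FK GK dF.
have F_le : mean F <= 4 / n%:R ^+ 2 * mean (fun x => g x ^+ 2) + 2 * mean (F \o radial).
  have n20 : 0 < n%:R / 2 :> R by rewrite divr_gt0.
  rewrite -(ler_pM2l n20).
  rewrite (_ : _ * (_ + _) = 2 / n%:R * mean (fun x => g x ^+ 2) + n%:R * mean (F \o radial)).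
    by rewrite -div; lra.
  by field; rewrite gt_eqF.
have := sqr_ge0 (mean f - m).
move: F_le; rewrite EF EFr -/m; move: (mean f) (mean (fun x => f x ^+ 2)).
by move=> b b2; rewrite sqrrB; lra.
Qed.

(** [radial] maps every point but the origin to the boundary, and both the origin
    and the complement of [Omega] are null sets.  The restriction [g \_ Omega] is
    measurable everywhere, as the change of variables requires. *)
Lemma cone_integral (g : 'rV[R]_n -> R) B : (0 < n)%N ->
  measurable_fun Omega g -> (forall x, Omega x -> `|g x| <= B) ->
  (\int[cone_measure Omega]_(x in bdry Omega) (g x)%:E)%E =
  (\int[uniform]_(x in Omega) g (radial x))%:E.
Proof.
move=> n_gt0 mg gB.
have -> : cone_measure Omega = pushforward uniform radial.
  by rewrite /cone_measure uniform_measureE.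
have mO := measurable_body; have mb := measurable_bdry.
have mN0 : measurable (~` [set (0 : 'rV[R]_n)]).
  by apply: measurableC; exact: measurable_set1_rV.
have bO := bdry_sub.
pose h := g \_ Omega.
have mh : measurable_fun setT h by apply/(measurable_restrictT _ mO).
have hE x : Omega x -> h x = g x by move=> Ox; rewrite /h patchE mem_set.
have mhr : measurable_fun setT (h \o radial).
  exact: (measurableT_comp mh measurable_radial).
have hB x : `|h (radial x)| <= B by rewrite hE ?gB//; exact: body_radial.
have ih A : measurable A -> uniform.-integrable A (EFin \o (h \o radial)).
  move=> mA; apply: (@uniform_integrable _ _ B) => //; last by move=> x _; exact: hB.
  exact: measurable_funTS mhr.
rewrite (eq_integral (EFin \o h)); first exact: measurable_radial; last first.
  by move=> x /set_mem/bO Ox; rewrite /= hE.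
move=> mradial.
transitivity (\int[uniform]_(x in radial @^-1` bdry Omega) (EFin \o (h \o radial)) x)%E.
  apply: (@integral_pushforward _ _ _ _ _ _ measurable_radial uniform (bdry Omega) (EFin \o h)) => //.
    exact/measurable_EFinP.
  by rewrite preimage_radial_bdry; exact: ih.
rewrite preimage_radial_bdry.
have mC : measurable (~` Omega) by exact: measurableC.
rewrite (negligible_integral mC mN0)//; last 2 first.
- exact: ih.
- by rewrite uniformE setICl measure0 mule0.
rewrite setDE setCK setIC -setDE -negligible_integral//; last 3 first.
- by rewrite -[X in measurable X]setCK; exact: measurableC.
- exact: ih.
- exact: uniform_origin.
have -> : (fun x => g (radial x)) = h \o radial.
  by apply/funext => x /=; rewrite hE//; exact: body_radial.
by rewrite fineK//; apply: integrable_fin_num => //; exact: ih.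
Qed.

Lemma body_continuous_bounded (g : 'rV[R]_n -> R) :
  (forall x, Omega x -> {for x, continuous g}) ->
  exists B, forall x, Omega x -> `|g x| <= B.
Proof.
move=> cg; have cgO : {within Omega, continuous g}.
  by apply: continuous_in_subspaceT => x /set_mem; exact: cg.
have [M [_ MO]] := compact_bounded (continuous_compact cgO Omega_compact).
exists (`|M| + 1) => x Ox; apply: MO; last by exists x.
by rewrite (le_lt_trans (ler_norm _))// ltrDl.
Qed.

End star_body.

(** * Radial derivatives of smooth functions *)

Lemma derive_dotmul (R : realType) (n : nat) (f : 'rV[R]_n -> R) (x v : 'rV[R]_n) :
  differentiable f x -> 'D_v f x = dotmul v (grad f x).
Proof.
move=> dfx; rewrite deriveE// {1}(row_sum_delta v) linear_sum.
by apply: eq_bigr => i _; rewrite linearZ mxE /partial deriveE.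
Qed.

Lemma is_derive_ray (R : realType) (n : nat) (f : 'rV[R]_n -> R) (x : 'rV[R]_n) (s : R) :
  s != 0 -> differentiable f (s *: x) ->
  is_derive s 1 (fun s : R => f (s *: x))
    (s^-1 * dotmul (s *: x) (grad f (s *: x))).
Proof.
move=> s0 dfx.
have E : (fun h : R => h^-1 *: (((fun s : R => f (s *: x)) \o shift s) (h *: (1 : R)) - f (s *: x)))
    = (fun h : R => h^-1 *: ((f \o shift (s *: x)) (h *: x) - f (s *: x))).
  by apply/funext => h /=; rewrite [h *: 1]mulr1 scalerDl.
apply: DeriveDef; first by rewrite /derivable E; exact: diff_derivable.
rewrite /derive E -/(derive f (s *: x) x) derive_dotmul// /dotmul mulr_sumr.
by apply: eq_bigr => i _; rewrite [in RHS]mxE -mulrA mulKf.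
Qed.

Lemma continuous_radial_derivative (R : realType) (n : nat) (f : 'rV[R]_n -> R) (x : 'rV[R]_n) :
  (forall i, {for x, continuous (partial i f)}) ->
  {for x, continuous (fun x => dotmul x (grad f x))}.
Proof.
move=> cf.
have -> : (fun x => dotmul x (grad f x)) = fun x => \sum_i x ord0 i * partial i f x.
  by apply/funext => y; apply: eq_bigr => i _; rewrite mxE.
apply: (cvg_big add_continuous) => [|i _]; first exact: nbhs_filter.
apply: cvgM; [exact: nbhs_filter|exact: coord_continuous|exact: cf].
Qed.

Theorem theorem1 (R : realType) (n : nat) (n_ge2 : (2 <= n)%N)
    (Omega : set 'rV[R]_n)
    (Omega_compact : compact Omega)
    (Omega_connected : connected Omega)
    (Omega_smooth : smooth_boundary Omega)
    (Omega_origin : interior Omega 0)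
    (Omega_star : Omega = [set x | gauge Omega x <= 1])
    (f : 'rV[R]_n -> R) (f_smooth : smooth_on Omega f) :
  (Var (uniform_measure Omega) Omega f <=
     (4 / n%:R ^+ 2)%:E *
       \int[uniform_measure Omega]_(x in Omega) (dotmul x (grad f x) ^+ 2)%:E
     + 2%:E * Var (cone_measure Omega) (bdry Omega) f)%E.
Proof.
have n_gt0 : (0 < n)%N by exact: ltnW.
have mO := measurable_body Omega_compact.
have [U [_ OU] smf] := f_smooth.
have [df cpf] : (forall x, U x -> differentiable f x) /\
    (forall i x, U x -> {for x, continuous (partial i f)}) := smf 1.
pose g x := dotmul x (grad f x).
have cf x : Omega x -> {for x, continuous f}.
  by move=> /OU /df; exact: differentiable_continuous.
have cg x : Omega x -> {for x, continuous g}.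
  by move=> /OU Ux; apply: continuous_radial_derivative => i; exact: cpf.
have mf := continuous_measurable_fun_rV mO cf.
have mg := continuous_measurable_fun_rV mO cg.
have [Cf fCf] := body_continuous_bounded Omega_compact cf.
have [Cg gCg] := body_continuous_bounded Omega_compact cg.
pose C := Num.max Cf Cg.
have fC x : Omega x -> `|f x| <= C by move=> Ox; rewrite le_max fCf.
have gC x : Omega x -> `|g x| <= C by move=> Ox; rewrite le_max gCg ?orbT.
have sqC (h : 'rV[R]_n -> R) : (forall x, Omega x -> `|h x| <= C) ->
    forall x, Omega x -> `|h x ^+ 2| <= C ^+ 2.
  move=> hC x Ox; rewrite normrX ler_pXn2r ?nnegrE ?hC//.
  by rewrite (le_trans _ (hC _ Ox)).
have mf2 : measurable_fun Omega (fun x => f x ^+ 2) by exact: measurable_funX.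
have mg2 : measurable_fun Omega (fun x => g x ^+ 2) by exact: measurable_funX.
have dfray x (s : R) : Omega x -> 0 < s -> s <= 1 ->
    is_derive s 1 (fun s : R => f (s *: x)) (s^-1 * g (s *: x)).
  move=> Ox s0 s1; apply: is_derive_ray; first by rewrite gt_eqF.
  by apply: df; apply: OU; exact: body_scale.
rewrite /Var !(cone_integral Omega_compact Omega_origin Omega_star n_gt0 mf fC).
rewrite (cone_integral Omega_compact Omega_origin Omega_star n_gt0 mf2 (sqC _ fC)).
rewrite (uniform_measureE Omega_compact).
rewrite !(Rintegral_fineK Omega_compact Omega_origin mO mf fC).
rewrite (Rintegral_fineK Omega_compact Omega_origin mO mf2 (sqC _ fC)).
rewrite (Rintegral_fineK Omega_compact Omega_origin mO mg2 (sqC _ gC)).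
rewrite -!EFin_expe -!EFinB -!EFinM -!EFinD lee_fin.
exact: (variance_le Omega_compact Omega_origin Omega_star n_gt0 mf mg fC gC dfray).
Qed.
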